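(* Let $K$ be a field and let $T^*_K$ be any one of $T_K$, $T_K^s$, $T_K^a$. The theory $T^*_K$ has positive quantifier elimination if and only if $K$ is finite.
   Context: A $K$-bilinear space is a $K$-vector space $V$ with a map $[\cdot,\cdot]:V\times V\to K$ linear in each argument; it is symmetric if $[x,y]=[y,x]$ for all $x,y$, and alternating if $[x,x]=0$ for all $x$. Positive logic: a (positive existential) formula is built from atomic formulas using $\wedge,\vee,\top,\bot,\exists$. An h-inductive sentence has the form $\forall\bar x(\varphi(\bar x)\to\psi(\bar x))$ with $\varphi,\psi$ such formulas; a (positive) theory is a set of h-inductive sentences. A homomorphism is a function between structures preserving truth of formulas; it is an immersion if it also reflects truth of formulas. A model $M$ of $T$ is existentially closed (e.c.) if every homomorphism $f:M\to N$ with $N\models T$ is an immersion. $T^{\mathrm{ec}}$ is the set of all h-inductive sentences true in every e.c. model of $T$. A theory $T$ has positive quantifier elimination if for every (positive existential) formula $\varphi(\bar x)$ there is a quantifier-free (positive) formula $\psi(\bar x)$ that is equivalent to $\varphi(\bar x)$ modulo $T^{\mathrm{ec}}$. $\mathcal L_K$ is the standard signature of $K$-vector spaces, with a unary function symbol for multiplication by each $\lambda\in K$, a relation symbol $\neq$ for inequality, and for every $\lambda\in K$ a binary relation symbol written $[x,y]=\lambda$, expressing that the bilinear product of $x$ and $y$ is $\lambda$. Every $K$-bilinear space is naturally viewed as an $\mathcal L_K$-structure. $T_K$, $T_K^s$, $T_K^a$ are the sets of all h-inductive $\mathcal L_K$-sentences true in all $K$-bilinear spaces, all symmetric $K$-bilinear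 spaces, and all alternating $K$-bilinear spaces, respectively. *)

(* Defs.v *)
From mathcomp Require Import all_boot all_algebra.
From mathcomp Require Import classical_sets cardinality.

Set Implicit Arguments.
Unset Strict Implicit.
Unset Printing Implicit Defensive.

Local Open Scope classical_set_scope.

Record signature := Signature {
  fsym : Type;
  farity : fsym -> nat;
  rsym : Type;
  rarity : rsym -> nat }.

Section Syntax.
Variable L : signature.

(* [term n] and [formula n] are the terms and the positive existential formulas
   whose free variables are among x_0, ..., x_(n-1). *)
Inductive term (n : nat) : Type :=
| Var of 'I_n
| App (f : fsym L) (args : 'I_(farity f) -> term n).

(* Equality is a logical symbol, hence [FEq] is atomic in every signature.
   In [FEx phi] the bound variable is x_0, and the free variable x_i of [FEx phi]
   is written x_(i+1) inside phi. *)
Inductive formula : nat -> Type :=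
| FEq n of term n & term n : formula n
| FRel n (r : rsym L) (args : 'I_(rarity r) -> term n) : formula n
| FTop n : formula n
| FBot n : formula n
| FAnd n of formula n & formula n : formula n
| FOr n of formula n & formula n : formula n
| FEx n of formula n.+1 : formula n.

Fixpoint quantifier_free n (phi : formula n) : bool :=
  match phi with
  | FEq _ _ _ | FRel _ _ _ | FTop _ | FBot _ => true
  | FAnd _ phi psi | FOr _ phi psi => quantifier_free phi && quantifier_free psi
  | FEx _ _ => false
  end.

(* The sentence "for all x_0, ..., x_(n-1), premise -> conclusion". *)
Record hinductive := HInductive {
  hvars : nat;
  premise : formula hvars;
  conclusion : formula hvars }.

Definition theory := set hinductive.

End Syntax.

Arguments Var {L n} i.
Arguments App {L n} f args.
Arguments FRel {L n} r args.
Arguments FTop {L n}.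
Arguments FBot {L n}.

Section Semantics.
Variable L : signature.

Record structure := Structure {
  carrier :> Type;
  finterp (f : fsym L) (args : 'I_(farity f) -> carrier) : carrier;
  rinterp (r : rsym L) (args : 'I_(rarity r) -> carrier) : Prop }.

Arguments finterp s f args : clear implicits.
Arguments rinterp s r args : clear implicits.

Fixpoint eval (M : structure) n (v : 'I_n -> M) (t : term L n) : M :=
  match t with
  | Var i => v i
  | App f ts => finterp M f (fun i => eval v (ts i))
  end.

Definition vcons (A : Type) n (a : A) (v : 'I_n -> A) (i : 'I_n.+1) : A :=
  oapp v a (unlift ord0 i).

Fixpoint holds (M : structure) n (phi : formula L n) : ('I_n -> M) -> Prop :=
  match phi in formula _ n return ('I_n -> M) -> Prop with
  | FEq _ s t => fun v => eval v s = eval v t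
  | FRel _ r ts => fun v => rinterp M r (fun i => eval v (ts i))
  | FTop _ => fun _ => True
  | FBot _ => fun _ => False
  | FAnd _ phi psi => fun v => holds phi v /\ holds psi v
  | FOr _ phi psi => fun v => holds phi v \/ holds psi v
  | FEx _ phi => fun v => exists a : M, holds phi (vcons a v)
  end.

Definition satisfies (M : structure) (s : hinductive L) : Prop :=
  forall v : 'I_(hvars s) -> M, holds (premise s) v -> holds (conclusion s) v.

Definition is_model (T : theory L) (M : structure) : Prop :=
  forall s, T s -> satisfies M s.

Definition homomorphism (M N : structure) (f : M -> N) : Prop :=
  forall n (phi : formula L n) (v : 'I_n -> M), holds phi v -> holds phi (f \o v).

Definition immersion (M N : structure) (f : M -> N) : Prop :=
  homomorphism f /\
  forall n (phi : formula L n) (v : 'I_n -> M), holds phi (f \o v) -> holds phi v.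

Definition existentially_closed (T : theory L) (M : structure) : Prop :=
  is_model T M /\
  forall (N : structure) (f : M -> N),
    is_model T N -> homomorphism f -> immersion f.

Definition theory_ec (T : theory L) : theory L :=
  [set s | forall M : structure, existentially_closed T M -> satisfies M s].

Definition equivalent_modulo (T : theory L) n (phi psi : formula L n) : Prop :=
  forall M : structure, is_model T M ->
  forall v : 'I_n -> M, holds phi v <-> holds psi v.

Definition positive_QE (T : theory L) : Prop :=
  forall n (phi : formula L n), exists psi : formula L n,
    quantifier_free psi /\ equivalent_modulo (theory_ec T) phi psi.

End Semantics.

Arguments finterp {L} s f args.
Arguments rinterp {L} s r args.

Section BilinearSpaces.
Local Open Scope ring_scope.
Variable K : fieldType.

Inductive LK_fsym : Type := Zero | Add | Opp | Scale of K.

Definition LK_farity (f : LK_fsym) : nat :=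
  match f with Zero => 0 | Add => 2 | Opp | Scale _ => 1 end.

(* [Product lam] is the binary relation symbol written "[x, y] = lam". *)
Inductive LK_rsym : Type := Neq | Product of K.

Definition LK_rarity (r : LK_rsym) : nat := 2.

Definition LK : signature := Signature LK_farity LK_rarity.

Section SpaceStructure.
Variables (V : lmodType K) (b : {biscalar V}).

Definition LK_finterp (f : LK_fsym) : ('I_(LK_farity f) -> V) -> V :=
  match f return ('I_(LK_farity f) -> V) -> V with
  | Zero => fun _ => 0
  | Add => fun x => x ord0 + x ord_max
  | Opp => fun x => - x ord0
  | Scale lam => fun x => lam *: x ord0
  end.

Definition LK_rinterp (r : LK_rsym) : ('I_(LK_rarity r) -> V) -> Prop :=
  match r return ('I_(LK_rarity r) -> V) -> Prop with
  | Neq => fun x => x ord0 <> x ord_max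
  | Product lam => fun x => b (x ord0) (x ord_max) = lam
  end.

Definition bilinear_structure : structure LK :=
  @Structure LK V LK_finterp LK_rinterp.

End SpaceStructure.

Definition is_symmetric (V : lmodType K) (b : {biscalar V}) : Prop :=
  forall x y : V, b x y = b y x.

Definition is_alternating (V : lmodType K) (b : {biscalar V}) : Prop :=
  forall x : V, b x x = 0.

Definition T_bilinear : theory LK :=
  [set s | forall (V : lmodType K) (b : {biscalar V}),
     satisfies (bilinear_structure b) s].

Definition T_symmetric : theory LK :=
  [set s | forall (V : lmodType K) (b : {biscalar V}), is_symmetric b ->
     satisfies (bilinear_structure b) s].

Definition T_alternating : theory LK :=
  [set s | forall (V : lmodType K) (b : {biscalar V}), is_alternating b ->
     satisfies (bilinear_structure b) s].

End BilinearSpaces.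

Arguments T_bilinear K : clear implicits.
Arguments T_symmetric K : clear implicits.
Arguments T_alternating K : clear implicits.

(* Main.v *)
Require Import Defs.
From HB Require Import structures.
From mathcomp Require Import freeg.
From mathcomp Require Import all_boot all_algebra.
From mathcomp Require Import classical_sets cardinality boolp functions.
From mathcomp Require Import ring.

(** Positive quantifier elimination only concerns e.c. models, and everything
there reduces to honest bilinear spaces. A model of the theory is a vector
space with partially defined products (over an infinite [K], by compactness, a
product may have no value in [K]), but every model has a homomorphism to a
bilinear space of the same kind ([model_completion]): a finite part of the
model is copied in some bilinear space, since otherwise the theory would
refute it, and because the conditions on a form are affine in its values, a
linear functional coherently selects a value for every product.

If [K] is finite, the quantifier-free type of an [n]-tuple, that is, its
linear relations and its Gram matrix, is one of finitely many and is described
by a positive quantifier-free formula. If tuples [v] and [w] of bilinear spaces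
[V] and [W] have the same type, any [x] in [V] can be matched by a [y] in a
one-point extension of [W] of the same kind ([one_point_extension]). Hence in
e.c. models the truth of an existential formula with quantifier-free matrix
depends on the type of the tuple only ([ec_basic_transfer]), and the formula is
the disjunction of the types that satisfy it ([finite_types_definable]).

If [K] is infinite, consider the formula: some [y] has [x0, y] = 1 and
[x1, y] = 0. It fails whenever [x0] is a multiple of [x1], and it holds for
independent [x0], [x1] in a space that is generic enough. A quantifier-free
equivalent that is true of independent, totally isotropic [x0], [x1] involves
only finitely many inequations, so it stays true of [(l x1, x1)] for all but
finitely many [l] ([cofinite_specialization]): a contradiction. This needs one
e.c. model with such a pair. In a saturated space, where every system of
consistent products with a new vector is realized, positive formulas true of a
tuple in any bilinear space are true of every tuple of the same type
([saturated_holds]); with [model_completion] this makes it e.c.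
([saturated_ec]). One saturated space is free on formal solutions of all such
systems ([generic_saturated]). *)

Set Implicit Arguments.
Unset Strict Implicit.
Unset Printing Implicit Defensive.

Import GRing.Theory.
Local Open Scope ring_scope.
Local Open Scope classical_set_scope.

(** * Linear functionals *)

Section LinearAlgebra.
Variables (K : fieldType) (V : lmodType K).

Definition subspace (S : set V) : Prop :=
  S 0 /\ forall a x y, S x -> S y -> S (a *: x + y).

(** A subspace that is maximal among those containing [S] but not [p], given
by Zorn's lemma, is a complement of the line of [p]; the functional is the
coordinate along [p]. *)
Lemma hyperplane (S : set V) (p : V) : subspace S -> ~ S p ->
  exists f : {scalar V}, f p = 1 /\ forall x, S x -> f x = 0.
Proof.
move=> [S0 SP] Sp.
(* The empty set has to satisfy [P], being the union of the empty chain. *)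
pose P (A : set V) := [/\ forall a x y, A x -> A y -> A (a *: x + y),
  A !=set0 -> S `<=` A & ~ A p].
have [A [[AP AS Ap] Amax]] : exists A, P A /\ forall B, A `<` B -> ~ P B.
  apply: Zorn_bigcup => F FP Ftot; split.
  - move=> a x y [A FA Ax] [B FB By].
    have [AB|BA] := Ftot _ _ FA FB.
      by exists B => //; have [h _ _] := FP _ FB; apply: h => //; exact: AB.
    by exists A => //; have [h _ _] := FP _ FA; apply: h => //; exact: BA.
  - move=> [x [A FA Ax]] y Sy; exists A => //.
    by have [_ h _] := FP _ FA; apply: h => //; exists x.
  - by move=> [A FA Ap]; have [_ _ h] := FP _ FA; exact: h.
have A0 : A 0.
  apply: contrapT => nA0; apply: (Amax S); last first.
    by split=> // _ x.
  suff -> : A = set0 by split=> // /(_ _ S0).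
  by apply: contrapT => /eqP/set0P/AS /(_ _ S0).
have {}AS : S `<=` A by apply: AS; exists 0.
have AD x y : A x -> A y -> A (x + y).
  by move=> Ax Ay; have := AP 1 _ _ Ax Ay; rewrite scale1r.
have AZ a x : A x -> A (a *: x).
  by move=> Ax; have := AP a _ _ Ax A0; rewrite addr0.
have uniqA x a b : A (x - a *: p) -> A (x - b *: p) -> a = b.
  move=> /(AP (-1)) h /h; rewrite scaleN1r opprB addrA.
  rewrite addrNK -scalerBl => /(AZ (a - b)^-1) Aab.
  apply: contrapT => /eqP; rewrite -subr_eq0 => ab; apply: Ap.
  by move: Aab; rewrite scalerA mulVf // scale1r.
have exA x : exists a, A (x - a *: p).
  have [Ax|Ax] := pselect (A x); first by exists 0; rewrite scale0r subr0.
  pose B := [set y | exists c, A (y - c *: x)].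
  have AB : A `<=` B by move=> y Ay; exists 0; rewrite scale0r subr0.
  have [[c Bp]|Bp] := pselect (B p); last first.
    exfalso; apply: (Amax B).
      split=> // /(_ x) BA; apply: Ax; apply: BA; exists 1.
      by rewrite scale1r subrr.
    split=> //; last by move=> _ y /AS /AB.
    move=> a y z [c Ac] [d Ad]; exists (a * c + d).
    rewrite scalerDl opprD addrACA -scalerA -scalerBr; exact: AP.
  have c0 : c != 0.
    by apply: contra_notN Ap => /eqP c0; move: Bp; rewrite c0 scale0r subr0.
  exists c^-1; have := AZ (- c^-1) _ Bp.
  by rewrite scalerBr !scaleNr opprK scalerA mulVf // scale1r addrC.
have [f fA] := choice exA.
have flin : GRing.linear_for *%R f.
  move=> a x y; apply: (uniqA (a *: x + y)) => //.
  rewrite scalerDl opprD addrACA -scalerA -scalerBr; exact: AP.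
pose F : {scalar V} := HB.pack f (GRing.isLinear.Build K V K *%R f flin).
exists F; split=> [|x Sx].
  by apply: (uniqA p) => //; rewrite scale1r subrr.
by apply: (uniqA x) => //; rewrite scale0r subr0; exact: AS.
Qed.

Definition lincomb n (a : 'I_n -> K) (v : 'I_n -> V) : V :=
  \sum_i a i *: v i.

End LinearAlgebra.

Section Lincomb.
Variables (K : fieldType).

Lemma lincombP (V : lmodType K) n c (a a' : 'I_n -> K) (v : 'I_n -> V) :
  lincomb (fun i => c * a i + a' i) v = c *: lincomb a v + lincomb a' v.
Proof.
rewrite /lincomb scaler_sumr -big_split; apply: eq_bigr => i _.
by rewrite scalerDl scalerA.
Qed.

Lemma lincombB (V : lmodType K) n (a a' : 'I_n -> K) (v : 'I_n -> V) :
  lincomb (fun i => a i - a' i) v = lincomb a v - lincomb a' v.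
Proof.
by rewrite /lincomb -sumrB; apply: eq_bigr => i _; rewrite scalerBl.
Qed.

Lemma lincomb_eq (V : lmodType K) n (a a' : 'I_n -> K) (v : 'I_n -> V) :
  lincomb a v = lincomb a' v <-> lincomb (fun i => a i - a' i) v = 0.
Proof.
by rewrite lincombB; split=> [->|/eqP]; [rewrite subrr|rewrite subr_eq0=> /eqP].
Qed.

Lemma lincomb_delta (V : lmodType K) n j (v : 'I_n -> V) :
  lincomb (fun i => (i == j)%:R) v = v j.
Proof.
rewrite /lincomb (bigD1 j) //= eqxx scale1r big1 ?addr0 // => i /negbTE ->.
by rewrite scale0r.
Qed.

Lemma lincomb_map (U V : lmodType K) (h : {linear U -> V}) n
    (a : 'I_n -> K) (v : 'I_n -> U) :
  h (lincomb a v) = lincomb a (h \o v).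
Proof. by rewrite linear_sum; apply: eq_bigr => i _; rewrite linearZ. Qed.

Lemma lincomb_cons (V : lmodType K) n (a : 'I_n.+1 -> K) x (v : 'I_n -> V) :
  lincomb a (vcons x v) = a ord0 *: x + lincomb (a \o lift ord0) v.
Proof.
rewrite /lincomb big_ord_recl /vcons unlift_none; congr (_ + _).
by apply: eq_bigr => i _; rewrite liftK.
Qed.

(** In [V * K], the subspace of the pairs [(\sum a i v i, - \sum a i c i)]
misses [(0, 1)]; a functional that vanishes on it and is 1 at [(0, 1)]
restricts to the required one on [V]. *)
Lemma prescribed_functional (V : lmodType K) n (v : 'I_n -> V) (c : 'I_n -> K) :
  (forall a, lincomb a v = 0 -> \sum_i a i * c i = 0) ->
  exists f : {scalar V}, forall i, f (v i) = c i.
Proof.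
move=> vc.
pose S : set (V * K^o)%type :=
  [set z | exists a, z = (lincomb a v, - \sum_i a i * c i)].
have [||f [f1 fS]] := @hyperplane _ _ S (0, 1).
- split.
    exists (fun=> 0); rewrite /lincomb !big1 ?oppr0 // => i _.
      by rewrite mul0r.
    by rewrite scale0r.
  move=> t _ _ [a ->] [a' ->]; exists (fun i => t * a i + a' i).
  rewrite lincombP; congr (_, _); rewrite /= /GRing.scale /= mulrN -opprD.
  congr (- _); rewrite mulr_sumr -big_split; apply: eq_bigr => i _.
  by rewrite mulrDl mulrA.
- move=> [a [/esym/vc ->]]; rewrite oppr0 => /eqP.
  by rewrite oner_eq0.
have glin : GRing.linear_for *%R (fun x : V => f (x, 0) : K).
  move=> t x y; rewrite -linearP.
  by congr (f (_, _)); rewrite /= scaler0 addr0.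
pose g : {scalar V} :=
  HB.pack (fun x : V => f (x, 0) : K) (GRing.isLinear.Build K V K *%R _ glin).
exists g => j /=; have : S (v j, - c j).
  exists (fun i => (i == j)%:R); rewrite lincomb_delta (bigD1 j) //= eqxx mul1r.
  by rewrite big1 ?addr0 // => i /negbTE ->; rewrite mul0r.
move/fS; have -> : (v j, - c j) = - c j *: (0, 1) + (v j, 0) :> V * K^o.
  by congr (_, _); rewrite /= ?scaler0 ?add0r // addr0 /GRing.scale /= mulr1.
by rewrite linearP /= f1 mulr1 => /eqP; rewrite addrC subr_eq0 => /eqP.
Qed.

End Lincomb.

(** * The three classes of bilinear spaces *)

Section Kinds.
Variable K : fieldType.

Inductive kind := General | Symmetric | Alternating.

Definition of_kind (k : kind) (V : lmodType K) (b : {biscalar V}) : Prop :=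
  match k with
  | General => True
  | Symmetric => is_symmetric b
  | Alternating => is_alternating b
  end.

Definition T_kind (k : kind) : theory (LK K) :=
  [set s | forall (V : lmodType K) (b : {biscalar V}), of_kind k b ->
     satisfies (bilinear_structure b) s].

Lemma kind_of_theory (T : theory (LK K)) :
  [\/ T = T_bilinear K, T = T_symmetric K | T = T_alternating K] ->
  exists k, T = T_kind k.
Proof.
case=> ->; [exists General|by exists Symmetric|by exists Alternating].
by apply/seteqP; split=> s sT V b; [move=> _|]; exact: sT.
Qed.

(** The constraints that a form of kind [k] puts on a vector [y] with [b x y =
f x], [b y x = g x] and [b y y = e]. *)
Definition compatible (k : kind) (V : lmodType K) (f g : V -> K) (e : K) :
    Prop :=
  match k with
  | General => True
  | Symmetric => forall x, g x = f x
  | Alternating => (forall x, g x = - f x) /\ e = 0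
  end.

Lemma alternating_anti (V : lmodType K) (b : {biscalar V}) :
  is_alternating b -> forall x y, b x y = - b y x.
Proof.
move=> alt x y; apply/eqP; rewrite -addr_eq0.
by have := alt (x + y); rewrite linearDl !linearDr !alt add0r addr0 => ->.
Qed.

End Kinds.

Lemma vcons0 (A : Type) n (a : A) (v : 'I_n -> A) : vcons a v ord0 = a.
Proof. by rewrite /vcons unlift_none. Qed.

Lemma vcons_lift (A : Type) n (a : A) (v : 'I_n -> A) i :
  vcons a v (lift ord0 i) = v i.
Proof. by rewrite /vcons liftK. Qed.

Lemma vcons_map (A B : Type) (h : A -> B) n (a : A) (v : 'I_n -> A) :
  h \o vcons a v = vcons (h a) (h \o v).
Proof.
by apply: funext => i /=; case: (unliftP ord0 i) => [j|] ->;
  rewrite ?vcons0 ?vcons_lift.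
Qed.

(** * Quantifier-free types of tuples *)

Section SameType.
Variable K : fieldType.

(** For tuples of bilinear spaces this is equality of quantifier-free types:
see [quantifier_free_same_type] and [same_type_basic]. *)
Definition same_type (V W : lmodType K) (b : {biscalar V}) (c : {biscalar W})
    n (v : 'I_n -> V) (w : 'I_n -> W) : Prop :=
  (forall a, lincomb a v = 0 <-> lincomb a w = 0) /\
  (forall i j, b (v i) (v j) = c (w i) (w j)).

Lemma gram_lincomb (V : lmodType K) (b : {biscalar V}) n (a a' : 'I_n -> K)
    (v : 'I_n -> V) :
  b (lincomb a v) (lincomb a' v) = \sum_i a i * \sum_j a' j * b (v i) (v j).
Proof.
rewrite /lincomb linear_sumlz; apply: eq_bigr => i _; rewrite linearZl_LR.
congr (_ * _); rewrite linear_sumr; apply: eq_bigr => j _.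
by rewrite linearZr_LR.
Qed.

Variables (V W : lmodType K) (b : {biscalar V}) (c : {biscalar W}).

Lemma same_type_sym n (v : 'I_n -> V) (w : 'I_n -> W) :
  same_type b c v w -> same_type c b w v.
Proof. by case=> lin gram; split=> [a|i j]; [split=> /lin|rewrite gram]. Qed.

Lemma same_type_gram n (v : 'I_n -> V) (w : 'I_n -> W) a a' :
  same_type b c v w ->
  b (lincomb a v) (lincomb a' v) = c (lincomb a w) (lincomb a' w).
Proof.
move=> [_ gram]; rewrite !gram_lincomb; apply: eq_bigr => i _.
by congr (_ * _); apply: eq_bigr => j _; rewrite gram.
Qed.

Lemma same_type_eq n (v : 'I_n -> V) (w : 'I_n -> W) a a' :
  same_type b c v w ->
  lincomb a v = lincomb a' v <-> lincomb a w = lincomb a' w.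
Proof. by move=> [lin _]; rewrite !lincomb_eq; exact: lin. Qed.

Lemma same_type_lincomb n (v : 'I_n -> V) (w : 'I_n -> W) a :
  same_type b c v w ->
  same_type b c (vcons (lincomb a v) v) (vcons (lincomb a w) w).
Proof.
move=> vw; split=> [d|].
  by rewrite !lincomb_cons -!lincombP; exact: vw.1.
have E (U : lmodType K) (u : 'I_n -> U) i :
    exists d, forall (U : lmodType K) (u : 'I_n -> U),
      vcons (lincomb a u) u i = lincomb d u.
  case: (unliftP ord0 i) => [j|] ->.
    by exists (fun i => (i == j)%:R) => *; rewrite vcons_lift lincomb_delta.
  by exists a => *; rewrite vcons0.
move=> i j; have [d Ed] := E V v i; have [d' Ed'] := E V v j.
by rewrite !Ed !Ed'; exact: same_type_gram.
Qed.

Lemma same_type_cons n (v : 'I_n -> V) (w : 'I_n -> W) x y :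
  same_type b c v w ->
  (forall i, b (v i) x = c (w i) y) -> (forall i, b x (v i) = c y (w i)) ->
  b x x = c y y ->
  (forall a, x <> lincomb a v) -> (forall a, y <> lincomb a w) ->
  same_type b c (vcons x v) (vcons y w).
Proof.
have new (U : lmodType K) (u : 'I_n -> U) z d : (forall a, z <> lincomb a u) ->
    lincomb d (vcons z u) = 0 <-> d ord0 = 0 /\ lincomb (d \o lift ord0) u = 0.
  move=> zu; rewrite lincomb_cons; split=> [|[-> ->]]; last first.
    by rewrite scale0r addr0.
  have [->|d0] := eqVneq (d ord0) 0; first by rewrite scale0r add0r.
  move=> /eqP; rewrite addr_eq0 => /eqP h; exfalso.
  apply: (zu (fun i => - (d ord0)^-1 * (d \o lift ord0) i + 0)).
  rewrite (lincombP _ _ (fun=> 0)) [lincomb (fun=> 0) u]big1 => [|i _].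
    by rewrite addr0 scaleNr -scalerN -h scalerA mulVf // scale1r.
  by rewrite scale0r.
move=> [lin gram] vx xv xx xN yN; split=> [d|i j].
  by rewrite !new //; split=> -[-> /lin ->].
by case: (unliftP ord0 i) => [i'|] ->; case: (unliftP ord0 j) => [j'|] ->;
  rewrite ?vcons0 ?vcons_lift.
Qed.

(** The products of [v] with [x] respect the linear relations of [v], which
are those of [w], so they transfer to functionals on all of [W]. *)
Lemma type_functionals k n (v : 'I_n -> V) (w : 'I_n -> W) x :
  of_kind k b -> same_type b c v w ->
  exists f g : {scalar W}, compatible k f g (b x x) /\
    forall i, f (w i) = b (v i) x /\ g (w i) = b x (v i).
Proof.
move=> kb [lin _].
have [|f fw] := @prescribed_functional _ _ _ w (fun i => b (v i) x).
  move=> a /lin av; rewrite -[RHS](linear0l b x) -av.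
  by rewrite /lincomb linear_sumlz; apply: eq_bigr => i _; rewrite linearZl_LR.
have [|g gw] := @prescribed_functional _ _ _ w (fun i => b x (v i)).
  move=> a /lin av; rewrite -[RHS](linear0r b x) -av /lincomb.
  by rewrite linear_sumr; apply: eq_bigr => i _; rewrite linearZr_LR.
case: k kb => /= kb; first by exists f, g.
  by exists f, f; split=> // i; rewrite fw kb.
exists f, (GRing.opp_fun f : {scalar W}); split=> // i; rewrite fw; split=> //.
by rewrite /= fw -alternating_anti.
Qed.

End SameType.

Lemma same_type_trans (K : fieldType) (U V W : lmodType K) (a : {biscalar U})
    (b : {biscalar V}) (c : {biscalar W}) n (u : 'I_n -> U) (v : 'I_n -> V)
    (w : 'I_n -> W) :
  same_type a b u v -> same_type b c v w -> same_type a c u w.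
Proof.
move=> [linuv gramuv] [linvw gramvw]; split=> [d|i j].
  by split=> [/linuv/linvw|/linvw/linuv].
by rewrite gramuv.
Qed.

(** * Positive formulas in bilinear spaces *)

Section Formulas.
Variable K : fieldType.
Implicit Types V W : lmodType K.

Lemma term_lincomb n (t : term (LK K) n) :
  exists a, forall V (b : {biscalar V}) (v : 'I_n -> V),
    eval (M := bilinear_structure b) v t = lincomb a v.
Proof.
elim: t => [i|f ts IH].
  by exists (fun j => (j == i)%:R) => V b v; rewrite lincomb_delta.
have {IH} [a aP] := choice IH.
case: f ts a aP => [|||l] ts a aP /=.
- exists (fun=> 0) => V b v; rewrite /lincomb big1 // => i _.
  by rewrite scale0r.
- exists (fun i => 1 * a ord0 i + a ord_max i) => V b v.
  by rewrite lincombP scale1r -!(aP _ _ b).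
- exists (fun i => 0 - a ord0 i) => V b v.
  rewrite (lincombB (fun=> 0)) -!(aP _ _ b).
  by rewrite [lincomb _ _]big1 ?sub0r // => i _; rewrite scale0r.
- exists (fun i => l * a ord0 i + 0) => V b v.
  rewrite (lincombP _ _ (fun=> 0)) -!(aP _ _ b) [lincomb _ _]big1 ?addr0 //.
  by move=> i _; rewrite scale0r.
Qed.

Lemma quantifier_free_same_type V W (b : {biscalar V}) (c : {biscalar W}) n
    (phi : formula (LK K) n) (v : 'I_n -> V) (w : 'I_n -> W) :
  same_type b c v w -> quantifier_free phi ->
  holds (M := bilinear_structure b) phi v ->
  holds (M := bilinear_structure c) phi w.
Proof.
move=> + + +; elim: phi v w => {n}
  [n s t|n r ts|//|//|n phi IHphi psi IHpsi|n phi IHphi psi IHpsi|//] v w vw /=.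
- move=> _; have [a aP] := term_lincomb s; have [a' a'P] := term_lincomb t.
  by rewrite !aP !a'P; exact: (same_type_eq _ _ vw).1.
- move=> _; have [a aP] := choice (fun i => term_lincomb (ts i)).
  case: r ts a aP => [|l] ts a aP /=; rewrite !aP.
    by move=> + /(same_type_eq _ _ vw); exact.
  by rewrite (same_type_gram _ _ vw).
- by move=> /andP[qphi qpsi] [/(IHphi _ _ vw qphi) ? /(IHpsi _ _ vw qpsi)].
- by move=> /andP[qphi qpsi]
    [/(IHphi _ _ vw qphi)|/(IHpsi _ _ vw qpsi)]; [left|right].
Qed.

(** One vector is required to realize products with a finite tuple, prescribed
by functionals on the whole space so that they are automatically consistent.
*)
Definition saturated k W (c : {biscalar W}) : Prop :=
  forall n (w : 'I_n -> W) (f g : {scalar W}) e, compatible k f g e ->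
  exists y, [/\ forall a, y <> lincomb a w,
    forall i, c (w i) y = f (w i), forall i, c y (w i) = g (w i) & c y y = e].

(** The matching of [v] with [w] extends to any further vector of [V]: a
vector in the span is matched by the same linear combination, another one by
saturation. *)
Lemma saturated_holds k V W (b : {biscalar V}) (c : {biscalar W}) n
    (phi : formula (LK K) n) (v : 'I_n -> V) (w : 'I_n -> W) :
  of_kind k b -> saturated k c -> same_type b c v w ->
  holds (M := bilinear_structure b) phi v ->
  holds (M := bilinear_structure c) phi w.
Proof.
move=> kb satc; elim: phi v w => {n}
  [n s t|n r ts|//|//|n phi IHphi psi IHpsi|n phi IHphi psi IHpsi|n phi IH]
  v w vw.
- exact: (quantifier_free_same_type (phi := FEq s t) vw).
- exact: (quantifier_free_same_type (phi := FRel r ts) vw).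
- by case=> /(IHphi _ _ vw) ? /(IHpsi _ _ vw).
- by case=> [/(IHphi _ _ vw)|/(IHpsi _ _ vw)]; [left|right].
- move=> [x phix].
  have [[a xa]|xN] := pselect (exists a, x = lincomb a v).
    exists (lincomb a w); apply: IH phix; rewrite xa; exact: same_type_lincomb.
  have [f [g [fg fgw]]] := type_functionals x kb vw.
  have [y [yN fy gy ey]] := satc _ w f g _ fg.
  exists y; apply: IH phix; apply: same_type_cons => // [i|i|a xa].
  + by rewrite fy (fgw i).1.
  + by rewrite gy (fgw i).2.
  + by apply: xN; exists a.
Qed.

Definition pair_fun (A : Type) (x y : A) (i : 'I_2) : A :=
  if i == ord0 then x else y.

(** The atomic formulas that describe a type; finitely many for each [n] when
[K] is finite. *)
Inductive basic_fact n :=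
  Vanish of 'I_n -> K | NonVanish of 'I_n -> K | ProductIs of 'I_n & 'I_n & K.

Definition zero_term n : term (LK K) n :=
  @App (LK K) n (Zero K) (fun i => Var (widen_ord (leq0n n) i)).

Fixpoint sum_term n (s : seq (K * 'I_n)) : term (LK K) n :=
  if s is (a, i) :: s then
    @App (LK K) n (Add K)
      (pair_fun (@App (LK K) n (Scale a) (fun=> Var i)) (sum_term s))
  else zero_term n.

Definition lincomb_term n (a : 'I_n -> K) : term (LK K) n :=
  sum_term [seq (a i, i) | i <- enum 'I_n].

Lemma eval_lincomb_term V (b : {biscalar V}) n (a : 'I_n -> K) (v : 'I_n -> V) :
  eval (M := bilinear_structure b) v (lincomb_term a) = lincomb a v.
Proof.
rewrite /lincomb_term /lincomb -big_enum.
by elim: (enum _) => [|i s IH] /=; rewrite ?big_nil // big_cons IH.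
Qed.

Definition basic_formula n (f : basic_fact n) : formula (LK K) n :=
  match f with
  | Vanish a => FEq (lincomb_term a) (zero_term n)
  | NonVanish a =>
      @FRel (LK K) n (Neq K) (pair_fun (lincomb_term a) (zero_term n))
  | ProductIs i j l => @FRel (LK K) n (Product l) (pair_fun (Var i) (Var j))
  end.

Lemma basic_formula_qf n (f : basic_fact n) : quantifier_free (basic_formula f).
Proof. by case: f. Qed.

(** A one-way transfer suffices, because a failing linear relation and the
failure of a value of a product are themselves positive facts. *)
Lemma same_type_basic V W (b : {biscalar V}) (c : {biscalar W}) n
    (v : 'I_n -> V) (w : 'I_n -> W) :
  (forall f, holds (M := bilinear_structure b) (basic_formula f) v ->
     holds (M := bilinear_structure c) (basic_formula f) w) ->
  same_type b c v w.
Proof.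
move=> vw; split=> [a|i j].
  split=> [va|wa].
    by have := vw (Vanish a); rewrite /= !eval_lincomb_term; exact.
  apply: contrapT => va; have := vw (NonVanish a).
  by rewrite /= !eval_lincomb_term; apply.
by have /= -> := vw (ProductIs i j (b (v i) (v j))).
Qed.

End Formulas.

(** * Homomorphisms *)

Section Homomorphisms.

Lemma homomorphism_of_atomic (L : signature) (M N : structure L) (h : M -> N) :
  (forall f args, h (finterp M f args) = finterp N f (h \o args)) ->
  (forall r args, rinterp M r args -> rinterp N r (h \o args)) ->
  homomorphism h.
Proof.
move=> hf hr.
have hev n (v : 'I_n -> M) (t : term L n) : h (eval v t) = eval (h \o v) t.
  elim: t => //= f ts IH; rewrite hf; congr finterp; exact/funext.
move=> n phi; elim: phi => {n}
  [n s t|n r ts|//|//|n phi IHphi psi IHpsi|n phi IHphi psi IHpsi|n phi IH]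
  v /=.
- by rewrite -!hev => ->.
- move=> /hr; congr rinterp; apply: funext => i; exact: hev.
- by case=> /IHphi ? /IHpsi.
- by case=> [/IHphi|/IHpsi]; [left|right].
- by case=> a /IH; rewrite vcons_map; exists (h a).
Qed.

Lemma homomorphism_comp (L : signature) (M N P : structure L)
    (h : M -> N) (g : N -> P) :
  homomorphism h -> homomorphism g -> homomorphism (g \o h).
Proof. by move=> hh hg n phi v /hh /hg. Qed.

Lemma isometry_homomorphism (K : fieldType) (V W : lmodType K)
    (b : {biscalar V}) (c : {biscalar W}) (h : {linear V -> W}) :
  injective h -> (forall x y, c (h x) (h y) = b x y) ->
  @homomorphism _ (bilinear_structure b) (bilinear_structure c) h.
Proof.
move=> hinj hc; apply: homomorphism_of_atomic.
  case=> [|||a] args /=; first exact: linear0.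
  - exact: linearD.
  - exact: linearN.
  - exact: linearZ.
by case=> [|l] args /=; [move=> + /hinj|rewrite hc].
Qed.

End Homomorphisms.

(** * Models of the theory map to bilinear spaces *)

Section Models.
Variable K : fieldType.

Definition no_args (A : Type) (i : 'I_0) : A :=
  False_rect A (notF (ltn_ord i)).

Lemma no_argsE (A : Type) (v : 'I_0 -> A) : v = @no_args A.
Proof. by apply: funext => -[]. Qed.

Lemma pair_funE (A : Type) (v : 'I_2 -> A) : v = pair_fun (v ord0) (v ord_max).
Proof.
apply: funext => i; rewrite /pair_fun; case: eqP => [->//|i0]; congr v.
by apply/val_inj; case: i i0 => -[|[|]] //= i h; case: h; exact/val_inj.
Qed.

Lemma one_argE (A : Type) (v : 'I_1 -> A) : v = (fun=> v ord0).
Proof. by apply: funext => i; rewrite ord1. Qed.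

Lemma pair_fun_map (A B : Type) (h : A -> B) x y :
  (fun i => h (pair_fun x y i)) = pair_fun (h x) (h y).
Proof. by apply: funext => i; rewrite /pair_fun; case: ifP. Qed.

Definition add_term n (s t : term (LK K) n) : term (LK K) n :=
  @App (LK K) n (Add K) (pair_fun s t).
Definition opp_term n (t : term (LK K) n) : term (LK K) n :=
  @App (LK K) n (Opp K) (fun=> t).
Definition scale_term n a (t : term (LK K) n) : term (LK K) n :=
  @App (LK K) n (Scale a) (fun=> t).

Section Operations.
Variable N : structure (LK K).
Definition model_zero : N := finterp N (Zero K) (@no_args N).
Definition model_add (x y : N) : N := finterp N (Add K) (pair_fun x y).
Definition model_opp (x : N) : N := finterp N (Opp K) (fun=> x).
Definition model_scale a (x : N) : N := finterp N (Scale a) (fun=> x).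

Lemma eval_zero_term n (v : 'I_n -> N) : eval v (zero_term K n) = model_zero.
Proof. by rewrite /= [X in finterp _ _ X]no_argsE. Qed.

Lemma eval_add_term n (v : 'I_n -> N) s t :
  eval v (add_term s t) = model_add (eval v s) (eval v t).
Proof. by rewrite /= pair_fun_map. Qed.

End Operations.

(** Atomic statements with parameters in an arbitrary type [X]. They suffice
to force bilinearity on the pull-back of a form, and using parameters instead
of variables makes finite lists of them easy to combine. *)
Inductive fact (X : Type) :=
  | SumFact of X & X & X
  | ScaleFact of K & X & X
  | ProductFact of X & X & K.

Definition fact_support (X : Type) (f : fact X) : seq X :=
  match f with
  | SumFact x y z => [:: x; y; z]
  | ScaleFact _ x y | ProductFact x y _ => [:: x; y]
  end.

Definition fact_holds (X : Type) (M : structure (LK K)) (u : X -> M)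
    (f : fact X) : Prop :=
  match f with
  | SumFact x y z => model_add (u x) (u y) = u z
  | ScaleFact a x y => model_scale a (u x) = u y
  | ProductFact x y l => rinterp M (Product l) (pair_fun (u x) (u y))
  end.

Definition facts_hold (X : Type) (M : structure (LK K)) (u : X -> M)
    (s : seq (fact X)) : Prop :=
  foldr (fun f P => fact_holds u f /\ P) True s.

Lemma facts_hold_cat (X : Type) (M : structure (LK K)) (u : X -> M) s t :
  facts_hold u (s ++ t) <-> facts_hold u s /\ facts_hold u t.
Proof.
elim: s => [|f s IH] /=; first by split=> [|[]].
by rewrite IH; split=> [[? []]|[[]]].
Qed.

Definition fact_formula (X : Type) n (idx : X -> 'I_n) (f : fact X) :
    formula (LK K) n :=
  match f with
  | SumFact x y z => FEq (add_term (Var (idx x)) (Var (idx y))) (Var (idx z))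
  | ScaleFact a x y => FEq (scale_term a (Var (idx x))) (Var (idx y))
  | ProductFact x y l =>
      @FRel (LK K) n (Product l) (pair_fun (Var (idx x)) (Var (idx y)))
  end.

Lemma holds_facts (X : Type) (M : structure (LK K)) n (idx : X -> 'I_n)
    (s : seq (fact X)) (v : 'I_n -> M) :
  holds (foldr (fun f => FAnd (fact_formula idx f)) FTop s) v <->
  facts_hold (v \o idx) s.
Proof.
elim: s => //= f s ->; case: f => [x y z|a x y|x y l] //=.
  by rewrite pair_fun_map.
by rewrite pair_fun_map.
Qed.

Variables (k : kind) (N : structure (LK K)).
Hypothesis NT : is_model (T_kind k) N.

Lemma model_eq n (s t : term (LK K) n) (v : 'I_n -> N) :
  (forall (V : lmodType K) (b : {biscalar V}) (w : 'I_n -> V),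
     eval (M := bilinear_structure b) w s =
     eval (M := bilinear_structure b) w t) ->
  eval v s = eval v t.
Proof.
move=> st; apply: (NT (s := HInductive FTop (FEq s t))) => // V b _ w _.
exact: st.
Qed.

Let var i (lti : (i < 3)%N) : term (LK K) 3 := Var (Ordinal lti).
Let x0 := @var 0 isT.
Let x1 := @var 1 isT.
Let x2 := @var 2 isT.
Let triple (x y z : N) (i : 'I_3) : N := nth x [:: x; y; z] i.

Let evalE := (eval_zero_term, eval_add_term).

Fact model_addA : associative (@model_add N).
Proof.
move=> x y z.
have := @model_eq _ (add_term x0 (add_term x1 x2))
  (add_term (add_term x0 x1) x2) (triple x y z).
by rewrite !evalE; apply => V b w /=; rewrite addrA.
Qed.

Fact model_addC : commutative (@model_add N).
Proof.
move=> x y.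
have := @model_eq _ (add_term x0 x1) (add_term x1 x0) (triple x y y).
by rewrite !evalE; apply => V b w /=; rewrite addrC.
Qed.

Fact model_add0 : left_id (model_zero N) (@model_add N).
Proof.
move=> x; have := @model_eq _ (add_term (zero_term K 3) x0) x0 (triple x x x).
by rewrite !evalE; apply => V b w /=; rewrite add0r.
Qed.

Fact model_addN : left_inverse (model_zero N) (@model_opp N) (@model_add N).
Proof.
move=> x.
have := @model_eq _ (add_term (opp_term x0) x0) (zero_term K 3) (triple x x x).
by rewrite !evalE; apply => V b w /=; rewrite addNr.
Qed.

Fact model_scaleA a b x :
  model_scale a (@model_scale N b x) = model_scale (a * b) x.
Proof.
have := @model_eq _ (scale_term a (scale_term b x0)) (scale_term (a * b) x0)
  (triple x x x).
by apply => V c w /=; rewrite scalerA.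
Qed.

Fact model_scale1 : left_id 1 (@model_scale N).
Proof.
move=> x; have := @model_eq _ (scale_term 1 x0) x0 (triple x x x).
by apply => V c w /=; rewrite scale1r.
Qed.

Fact model_scaleDr : right_distributive (@model_scale N) (@model_add N).
Proof.
move=> a x y.
have := @model_eq _ (scale_term a (add_term x0 x1))
  (add_term (scale_term a x0) (scale_term a x1)) (triple x y y).
by rewrite /= !pair_fun_map; apply => V c w /=; rewrite scalerDr.
Qed.

Fact model_scaleDl x :
  {morph (@model_scale N)^~ x : a b / a + b >-> model_add a b}.
Proof.
move=> a b.
have := @model_eq _ (scale_term (a + b) x0)
  (add_term (scale_term a x0) (scale_term b x0)) (triple x x x).
by rewrite /= !pair_fun_map; apply => V c w /=; rewrite scalerDl.
Qed.

(** The proof that [N] is a model is a phantom parameter on which the vector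
space structure of [N] depends. *)
Definition model_space (_ : is_model (T_kind k) N) : Type := N.
Local Notation V := (model_space NT).
HB.instance Definition _ := gen_eqMixin V.
HB.instance Definition _ := gen_choiceMixin V.
HB.instance Definition _ := GRing.isZmodule.Build V
  model_addA model_addC model_add0 model_addN.
HB.instance Definition _ := GRing.Zmodule_isLmodule.Build K V
  model_scaleA model_scale1 model_scaleDr model_scaleDl.

(** If no bilinear space of kind [k] realized [s], then the sentence stating
that the conjunction of [s] implies falsity would belong to the theory, and
[N] would refute it. *)
Lemma facts_approximation (s : seq (fact N)) :
  facts_hold id s -> exists (W : lmodType K) (b : {biscalar W}),
    of_kind k b /\
    exists u : N -> W, facts_hold (M := bilinear_structure b) u s.
Proof.
move=> sN.
pose l : seq V := flatten [seq fact_support f | f <- s].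
pose idx (x : N) : 'I_(size l).+1 := inord (index (x : V) l).
pose v (i : 'I_(size l).+1) : N := nth (0 : V) l i.
have vidx (x : V) : x \in l -> v (idx x) = x.
  by move=> xl; rewrite /v inordK ?nth_index // ltnS index_size.
have {}sN : facts_hold (v \o idx) s.
  have : {subset (flatten [seq fact_support f | f <- s] : seq V) <= l} by [].
  elim: (s) sN => //= f t IH [fN tN] sub; split; last first.
    by apply: IH => // x xt; apply: sub; rewrite mem_cat xt orbT.
  case: f fN sub => [x y z|a x y|x y c] /= fN sub;
    by rewrite !vidx //; apply: sub; rewrite !inE eqxx ?orbT.
apply: contrapT => noW.
pose facts_contradict :=
  HInductive (foldr (fun f => FAnd (fact_formula idx f)) FTop s) FBot.
apply: (NT (s := facts_contradict) _ (v := v)); last exact/holds_facts.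
move=> W b kb w /holds_facts ws; apply: noW; exists W, b; split=> //.
by exists (w \o idx).
Qed.

(** Consider functions [G] of a binary function [B : N -> N -> K]. Those that
finitely many true facts force to vanish at every pulled-back form [B] make up
a subspace, to which the constant 1 does not belong by [facts_approximation].
A functional [f] that vanishes on it with [f 1 = 1] is a linear analogue of an
ultrafilter: the value of [f] at [B |-> B x y] is a coherent choice for the
product of [x] and [y], since bilinearity, the defined products and the kind
all are linear equations forced by facts. *)
Theorem model_completion : exists (W : lmodType K) (b : {biscalar W}),
  of_kind k b /\ exists h : N -> W,
  @homomorphism _ N (bilinear_structure b) h.
Proof.
pose E : lmodType K := ((V -> V -> K) -> K^o).
pose forced (s : seq (fact N)) (G : E) :=
  forall (W : lmodType K) (b : {biscalar W}) (u : N -> W), of_kind k b ->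
  facts_hold (M := bilinear_structure b) u s ->
  G (fun x y => b (u x) (u y)) = 0.
pose S : set E := [set G | exists2 s, facts_hold id s & forced s G].
have [||f [f1 fS]] := @hyperplane _ _ S (cst 1).
- split; first by exists [::].
  move=> a G G' [s sN sG] [s' s'N s'G'].
  exists (s ++ s'); first exact/facts_hold_cat.
  move=> W b u kb /facts_hold_cat[us us'].
  pose B x y := b (u x) (u y); change (a *: G B + G' B = 0).
  by rewrite sG // s'G' // scaler0 addr0.
- move=> [s sN sG]; have [W [b [kb [u us]]]] := facts_approximation sN.
  by have /eqP := sG W b u kb us; rewrite oner_eq0.
have fE s (G G' : E) : facts_hold id s -> forced s (G - G') -> f G = f G'.
  move=> sN sG; apply/eqP; rewrite -subr_eq0 -linearB; apply/eqP/fS.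
  by exists s.
pose ev (x y : V) : E := fun B => B x y.
pose c x y : K := f (ev x y).
have clin : bilinear_for *%R *%R c.
  split=> [z a x y|x a y z]; rewrite -linearP.
    pose s := [:: ScaleFact a x (a *: x); SumFact (a *: x) y (a *: x + y)].
    apply: (fE s) => //.
    move=> W b u kb /= [ux [uxy _]].
    change (b (u (a *: x + y)) (u z) - (a * b (u x) (u z) + b (u y) (u z)) = 0).
    by rewrite -uxy -ux /model_add /model_scale /= linearDl linearZl_LR subrr.
  pose s := [:: ScaleFact a y (a *: y); SumFact (a *: y) z (a *: y + z)].
  apply: (fE s) => //.
  move=> W b u kb /= [uy [uyz _]].
  change (b (u x) (u (a *: y + z)) - (a * b (u x) (u y) + b (u x) (u z)) = 0).
  by rewrite -uyz -uy /model_add /model_scale /= linearDr linearZr_LR subrr.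
pose C : {biscalar V} :=
  HB.pack c (bilinear_isBilinear.Build K V V K *%R *%R c clin).
have Cval x y l : rinterp N (Product l) (pair_fun x y) -> C x y = l.
  move=> xyl; have -> : l = f (l *: cst 1).
    by rewrite linearZ /= f1; exact/esym/mulr1.
  apply: (fE [:: ProductFact x y l]) => // W b u kb /= [uxy _].
  change (b (u x) (u y) - l * 1 = 0).
  by rewrite mulr1 -{}uxy /= subrr.
exists V, C; split.
  case ek: k => //=.
    move=> x y; apply: (fE [::]) => // W b u; rewrite ek => kb _.
    change (b (u x) (u y) - b (u y) (u x) = 0).
    by rewrite kb subrr.
  move=> x; rewrite -[RHS](linear0 f).
  apply: (fE [::]) => // W b u; rewrite ek => kb _.
  change (b (u x) (u x) - 0 = 0).
  by rewrite kb subrr.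
exists id; apply: homomorphism_of_atomic.
  case=> [|||a] args /=.
  - by rewrite [args]no_argsE.
  - by rewrite [args in LHS]pair_funE.
  - by rewrite [args in LHS]one_argE.
  - by rewrite [args in LHS]one_argE.
case=> [|l] args /=; last by rewrite [args in X in X -> _]pair_funE => /Cval.
rewrite [args in X in X -> _]pair_funE => neq eq.
pose neq_irrefl :=
  @HInductive (LK K) 1 (@FRel (LK K) 1 (Neq K) (fun=> Var ord0)) FBot.
apply: (NT (s := neq_irrefl) _ (v := fun=> args ord0)) => [W b kb w|] /=.
  exact.
have -> : (fun=> args ord0) =
    pair_fun (args ord0) (args ord_max) :> ('I_2 -> N).
  by rewrite [RHS]/pair_fun -eq; apply: funext => i /=; case: ifP.
exact: neq.
Qed.

End Models.

(** * A generic bilinear space *)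

Section GenericSpace.
Variables (K : fieldType) (k : kind).

(** [Generator s c d e] is a formal vector [y] whose products with the earlier
generators [s i] are [[s i, y] = c i] and [[y, s i] = d i], and with [[y, y] =
e]. *)
Inductive generator :=
  Generator (n : nat) of 'I_n -> generator & 'I_n -> K & 'I_n -> K & K.

HB.instance Definition _ := gen_eqMixin generator.
HB.instance Definition _ := gen_choiceMixin generator.

Definition mentions (h g : generator) : Prop :=
  let: Generator n s _ _ _ := h in exists i, s i = g.

(** The relation is well founded, so it has no 2-cycle. *)
Lemma mentions_asym g h : mentions h g -> mentions g h -> False.
Proof.
elim: g h => n s IH c d e h hg [i ih]; apply: (IH i (Generator s c d e)) => //.
  by exists i.
by rewrite ih.
Qed.

Lemma mentions_irrefl g : ~ mentions g g.
Proof. by move=> gg; exact: (mentions_asym gg). Qed.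

Definition left_value (h g : generator) : option K :=
  let: Generator n s c _ _ := h in omap c [pick i | s i == g].

(** For the symmetric and the alternating kind, the right product is
determined by the left one. *)
Definition right_value (h g : generator) : option K :=
  let: Generator n s c d _ := h in
  omap (fun i => match k with
                 | General => d i
                 | Symmetric => c i
                 | Alternating => - c i
                 end) [pick i | s i == g].

Definition norm_value (h : generator) : K :=
  let: Generator _ _ _ _ e := h in
  match k with Alternating => 0 | _ => e end.

(** By [mentions_asym] at most one of the two lookups succeeds; unrelated
generators are orthogonal. *)
Definition generator_form (g h : generator) : K :=
  if g == h then norm_value g else
  match left_value h g, right_value g h with
  | Some c, _ => c
  | None, Some d => d
  | None, None => 0
  end.

Lemma left_value_mentions h g c : left_value h g = Some c -> mentions h g.
Proof. by case: h => n s c' d e /=; case: pickP => //= i /eqP; exists i. Qed.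

Lemma right_valueE h g : right_value h g =
  match k with
  | General => right_value h g
  | Symmetric => left_value h g
  | Alternating => omap -%R (left_value h g)
  end.
Proof. by case: h => n s c d e /=; case: k => //; case: pickP. Qed.

Lemma generator_form_sym g h : k = Symmetric ->
  generator_form g h = generator_form h g.
Proof.
move=> ek; rewrite /generator_form eq_sym; case: eqP => [->//|_].
rewrite (right_valueE h g) (right_valueE g h) ek /=.
case hg : (left_value h g) => [c|]; case gh : (left_value g h) => [d|] //.
by case: (mentions_asym (left_value_mentions hg) (left_value_mentions gh)).
Qed.

Lemma generator_form_anti g h : k = Alternating ->
  generator_form g h = - generator_form h g.
Proof.
move=> ek; rewrite /generator_form eq_sym; case: eqP => [->|_].
  by case: g => /= *; rewrite ek oppr0.
rewrite (right_valueE h g) (right_valueE g h) ek /=.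
case hg : (left_value h g) => [c|]; case gh : (left_value g h) => [d|] //=;
  rewrite ?opprK ?oppr0 //.
by case: (mentions_asym (left_value_mentions hg) (left_value_mentions gh)).
Qed.

Lemma generator_form_alt g : k = Alternating -> generator_form g g = 0.
Proof.
by move=> ek; rewrite /generator_form eqxx; case: g => /= *; rewrite ek.
Qed.

Local Notation V := {freeg generator / K}.
Local Notation "<< g >>" := (Freeg [:: (1 : K, g)]) : ring_scope.

Lemma freegUZ (a : K) (g : generator) : Freeg [:: (a, g)] = a *: << g >> :> V.
Proof. by apply/eqP/freeg_eqP => h; rewrite coeffZ !coeffU mul1r. Qed.

Lemma generator_decomposition (x : V) :
  x = \sum_(g <- dom x) coeff g x *: << g >>.
Proof.
by rewrite -[LHS]freeg_sumE; apply: eq_bigr => g _; rewrite freegUZ.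
Qed.

Definition linear_extension (h : generator -> K) (x : V) : K :=
  fglift (h : generator -> K^o) x.

HB.instance Definition _ h :=
  GRing.isZmodMorphism.Build V K (linear_extension h)
  (@lift_is_additive K generator K^o h).

Fact linear_extensionZ h : scalable_for *%R (linear_extension h).
Proof.
move=> a x; have extU b g : linear_extension h (Freeg [:: (b, g)]) = b * h g.
  by rewrite /linear_extension liftU.
rewrite -[a *: x]/(\sum_(g <- dom x) Freeg [:: (a * coeff g x, g)]).
rewrite -[in RHS](freeg_sumE x) !(raddf_sum (linear_extension h)) mulr_sumr.
by apply: eq_bigr => g _; rewrite /= !extU mulrA.
Qed.

HB.instance Definition _ h := GRing.isScalable.Build K V K *%R
  (linear_extension h) (@linear_extensionZ h).

Lemma linear_extension_gen h g : linear_extension h << g >> = h g.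
Proof. by rewrite /linear_extension liftU scale1r. Qed.

Lemma linear_extension_sum h x :
  linear_extension h x = \sum_(g <- dom x) coeff g x * h g.
Proof.
rewrite {1}[x]generator_decomposition linear_sum; apply: eq_bigr => g _.
by rewrite linearZ /= linear_extension_gen.
Qed.

Definition generic_form (x y : V) : K :=
  linear_extension (fun g => linear_extension (generator_form g) y) x.

Fact generic_form_bilinear : bilinear_for *%R *%R generic_form.
Proof.
split=> [y a x x'|x a y y']; rewrite /generic_form ?linearP //.
rewrite 3!linear_extension_sum /= mulr_sumr -big_split; apply: eq_bigr => g _.
by rewrite linearP /= mulrDr mulrCA.
Qed.

HB.instance Definition _ :=
  bilinear_isBilinear.Build K V V K *%R *%R generic_form generic_form_bilinear.

Lemma generic_form_gen g h : generic_form << g >> << h >> = generator_form g h.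
Proof. by rewrite /generic_form !linear_extension_gen. Qed.

Lemma generic_form_sum x y : generic_form x y =
  \sum_(g <- dom x) \sum_(h <- dom y)
    coeff g x * coeff h y * generator_form g h.
Proof.
rewrite /generic_form linear_extension_sum; apply: eq_bigr => g _.
rewrite linear_extension_sum mulr_sumr.
by apply: eq_bigr => h _; rewrite mulrA.
Qed.

Lemma generic_of_kind : of_kind k (generic_form : {biscalar V}).
Proof.
case ek : k => //=.
  move=> x y /=; rewrite !generic_form_sum exchange_big; apply: eq_bigr => g _.
  by apply: eq_bigr => h _; rewrite generator_form_sym // [_ * coeff _ _]mulrC.
have anti x y : generic_form x y = - generic_form y x.
  rewrite !generic_form_sum exchange_big -sumrN; apply: eq_bigr => g _ /=.
  rewrite -sumrN; apply: eq_bigr => h _.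
  by rewrite generator_form_anti // [_ * coeff _ _]mulrC mulrN.
elim/freeg_ind_dom0 => [|a g x _ _ IH]; first by rewrite linear0r.
rewrite freegUZ linearDl !linearDr /= IH addr0 [generic_form x _]anti addrK.
rewrite linearZl_LR linearZr_LR /= generic_form_gen generator_form_alt //.
by rewrite !mulr0.
Qed.

(** A tuple is supported on finitely many generators, and a generator that
mentions all of them with the prescribed values is the required vector. *)
Lemma generic_saturated : saturated k (generic_form : {biscalar V}).
Proof.
move=> n w f g e fg.
pose s := flatten [seq dom (w i) | i <- enum 'I_n].
pose y0 := Generator (tnth (in_tuple s)) (fun i => f << tnth (in_tuple s) i >>)
  (fun i => g << tnth (in_tuple s) i >>) e.
have sw i : {subset dom (w i) <= s}.
  move=> z zw; apply/flattenP; exists (dom (w i)) => //.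
  by apply: map_f; rewrite mem_enum.
have y0s z : z \in s -> mentions y0 z.
  by move=> zs; have /tnthP[i ->] : z \in in_tuple s by []; exists i.
have Ny0s : y0 \notin s by apply/negP => /y0s /mentions_irrefl.
have y0E z : z \in s ->
    generator_form z y0 = f << z >> /\ generator_form y0 z = g << z >>.
  move=> zs; have zy0 : z != y0 by apply: contraNneq Ny0s => <-.
  rewrite /generator_form [y0 == z]eq_sym (negbTE zy0).
  case zN: (left_value z y0) => [c|].
    by case: (mentions_asym (left_value_mentions zN) (y0s _ zs)).
  have /tnthP[i0 zi0] : z \in in_tuple s by [].
  rewrite /=; case: pickP => [i /eqP siz|/(_ i0)]; last by rewrite -zi0 eqxx.
  rewrite /= siz; split=> //.
  by case: (k) fg => [|->|[-> _]].
have lin (h h' : {scalar V}) x : {subset dom x <= s} ->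
    (forall z, z \in s -> h << z >> = h' << z >>) -> h x = h' x.
  move=> xs hh'; rewrite [x]generator_decomposition !linear_sum.
  rewrite big_seq [RHS]big_seq.
  by apply: eq_bigr => z /xs /hh'; rewrite !linearZ /= => ->.
exists << y0 >>; split => [a ya|i|i|].
- have := congr1 (coeff y0) ya.
  rewrite coeffU eqxx mulr1 raddf_sum big1 => [/eqP|i _].
    by rewrite oner_eq0.
  rewrite /= coeffZ coeff_outdom ?mulr0 //.
  by apply: contra Ny0s; exact: sw.
- apply: (lin (applyr (generic_form : {biscalar V}) << y0 >>) f _ (sw i)).
  by move=> z /y0E[<- _]; exact: generic_form_gen.
- apply: (lin ((generic_form : {biscalar V}) << y0 >> : {scalar V}) g _ (sw i)).
  by move=> z /y0E[_ <-]; exact: generic_form_gen.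
- rewrite [LHS]generic_form_gen /generator_form eqxx /=.
  by case: (k) fg => // -[_ ->].
Qed.

End GenericSpace.

(** * Existential closedness and one-point extensions *)

Section ExistentiallyClosed.
Variables (K : fieldType) (k : kind).

Lemma homomorphism_same_type (V W : lmodType K) (b : {biscalar V})
    (c : {biscalar W}) (h : V -> W) n (v : 'I_n -> V) :
  @homomorphism _ (bilinear_structure b) (bilinear_structure c) h ->
  same_type b c v (h \o v).
Proof. by move=> hh; apply: same_type_basic => f /hh. Qed.

(** A homomorphism to a model continues to a bilinear space by
[model_completion], where the image of a tuple has the same type as the tuple;
[saturated_holds] brings positive formulas back. *)
Lemma saturated_ec (V : lmodType K) (b : {biscalar V}) :
  of_kind k b -> saturated k b ->
  existentially_closed (T_kind k) (bilinear_structure b).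
Proof.
move=> kb satb; split=> [s sT|N h NT hh]; first exact: sT.
split=> // n phi v /= phihv.
have [W [c [kc [g gh]]]] := model_completion NT.
apply: (saturated_holds kc satb _ (gh _ _ _ phihv)).
apply: same_type_sym; apply: homomorphism_same_type (homomorphism_comp hh gh).
Qed.

Section OnePointExtension.
Variables (V : lmodType K) (b : {biscalar V}) (f g : {scalar V}) (e : K).

(** The form on [V + K y] with [b x y = f x], [b y x = g x] and [b y y = e].
*)
Definition extension_form (x y : V * K^o) : K :=
  b x.1 y.1 + f x.1 * y.2 + x.2 * (g y.1 + e * y.2).

Fact extension_form_bilinear : bilinear_for *%R *%R extension_form.
Proof.
split=> [y a x x'|x a y y']; rewrite /extension_form /=.
  by rewrite linearPl linearP /= /GRing.scale /=; ring.
by rewrite linearPr linearP /= /GRing.scale /=; ring.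
Qed.

HB.instance Definition _ :=
  bilinear_isBilinear.Build K (V * K^o)%type (V * K^o)%type K *%R *%R
  extension_form extension_form_bilinear.

Lemma extension_of_kind : of_kind k b -> compatible k f g e ->
  of_kind k (extension_form : {biscalar V * K^o}).
Proof.
case: k => //= kb.
  by move=> gf x y; rewrite /= /extension_form (kb x.1) !gf; ring.
by move=> [gf e0] x; rewrite /= /extension_form (kb x.1) gf e0; ring.
Qed.

Definition extension_embedding (x : V) : V * K^o := (x, 0).

Fact extension_embedding_linear : linear extension_embedding.
Proof. by move=> a x y; congr (_, _); rewrite /= scaler0 addr0. Qed.

HB.instance Definition _ := GRing.isLinear.Build K V (V * K^o)%type *:%R
  extension_embedding extension_embedding_linear.

Lemma extension_embedding_hom :
  @homomorphism _ (bilinear_structure b)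
    (bilinear_structure (extension_form : {biscalar V * K^o}))
    extension_embedding.
Proof.
apply: (isometry_homomorphism (h := extension_embedding)) => [x y [] //|x y].
by rewrite /= /extension_form /= !mulr0 mul0r !addr0.
Qed.

End OnePointExtension.

Lemma one_point_extension (V W : lmodType K) (b : {biscalar V})
    (c : {biscalar W}) n (v : 'I_n -> V) (w : 'I_n -> W) x :
  of_kind k b -> of_kind k c -> same_type b c v w ->
  exists (U : lmodType K) (d : {biscalar U}) (h : W -> U) (y : U),
  [/\ of_kind k d,
    @homomorphism _ (bilinear_structure c) (bilinear_structure d) h &
    same_type b d (vcons x v) (vcons y (h \o w))].
Proof.
move=> kb kc vw.
have [[a xa]|xN] := pselect (exists a, x = lincomb a v).
  exists W, c, id, (lincomb a w); split=> //.
  by rewrite xa; exact: same_type_lincomb.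
have [f [g [fg fgw]]] := type_functionals x kb vw.
exists (W * K^o)%type, (extension_form c f g (b x x) : {biscalar W * K^o}).
exists (@extension_embedding W), (0, 1); split.
- exact: extension_of_kind.
- exact: extension_embedding_hom.
have wE i : (@extension_embedding W \o w) i = (w i, 0) by [].
have hw := homomorphism_same_type w (@extension_embedding_hom _ c f g (b x x)).
apply: same_type_cons => [|i|i||a xa|a ya].
- by apply: same_type_trans hw.
- by rewrite wE /= /extension_form /= linear0r (fgw i).1; ring.
- by rewrite wE /= /extension_form /= linear0l linear0 (fgw i).2; ring.
- by rewrite /= /extension_form /= linear0l !linear0; ring.
- by apply: xN; exists a.
have /(congr1 snd) /eqP := ya; rewrite -lincomb_map /= oner_eq0 //.
Qed.

End ExistentiallyClosed.

(** * Finitely many types *)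

Section FiniteTypes.
Variables (L : signature) (C : structure L -> Prop) (I : finType) (n : nat).
Variables (alpha : I -> formula L n) (phi : formula L n).

Definition conjunction (s : seq I) : formula L n :=
  foldr (fun i => FAnd (alpha i)) FTop s.

Lemma holds_conjunction (M : structure L) (v : 'I_n -> M) s :
  holds (conjunction s) v <-> forall i, i \in s -> holds (alpha i) v.
Proof.
elim: s => [|i s IH] /=; first by split.
rewrite IH; split=> [[vi vs] j|vs].
  by rewrite in_cons => /predU1P[->|/vs].
by split=> [|j js]; apply: vs; rewrite in_cons ?eqxx ?js ?orbT.
Qed.

(** The formula is the disjunction, over the sets [A] of indices that contain
every [i] with [alpha i] true for some realization of [phi], of the
conjunctions of the [alpha i] with [i] in [A]. *)
Lemma finite_types_definable :
  (forall i, quantifier_free (alpha i)) ->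
  (forall (M M' : structure L) (v : 'I_n -> M) (v' : 'I_n -> M'), C M -> C M' ->
     (forall i, holds (alpha i) v -> holds (alpha i) v') ->
     holds phi v -> holds phi v') ->
  exists psi, quantifier_free psi /\
    forall M, C M -> forall v : 'I_n -> M, holds phi v <-> holds psi v.
Proof.
move=> alphaqf transfer.
pose realized (A : {set I}) := exists (M : structure L) (v : 'I_n -> M),
  [/\ C M, holds phi v & forall i, holds (alpha i) v -> i \in A].
pose As := [seq A <- enum {set I} | `[< realized A >]].
exists (foldr (fun A : {set I} => FOr (conjunction (enum A))) FBot As); split.
  elim: As => //= A As' ->; rewrite andbT.
  by elim: (enum A) => //= i s ->; rewrite alphaqf.
have psiE (M : structure L) (v : 'I_n -> M) :
    holds (foldr (fun A : {set I} => FOr (conjunction (enum A))) FBot As) v <->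
    exists2 A, A \in As & forall i, i \in A -> holds (alpha i) v.
  elim: As => [|A As' IH] /=; first by split=> // -[].
  rewrite IH holds_conjunction; split=> [[vA|[B BAs vB]]|[B]].
  - by exists A; rewrite ?mem_head // => i iA; apply: vA; rewrite mem_enum.
  - by exists B; rewrite ?in_cons ?BAs ?orbT.
  - rewrite in_cons => /predU1P[-> vA|BAs vB]; last by right; exists B.
    by left=> i; rewrite mem_enum; exact: vA.
move=> M CM v; rewrite psiE; split=> [phiv|[A]].
  exists [set i | `[< holds (alpha i) v >]]%SET => [|i]; last first.
    by rewrite inE => /asboolP.
  rewrite mem_filter mem_enum andbT; apply/asboolP; exists M, v.
  by split=> // i vi; rewrite inE; apply/asboolP.
rewrite mem_filter => /andP[/asboolP[M' [v' [CM' phiv' v'A]]] _] vA.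
by apply: transfer phiv' => // i /v'A /vA.
Qed.

End FiniteTypes.

(** * Quantifier elimination over a finite field *)

Section Elimination.
Variables (K : fieldType) (k : kind).
Local Notation T := (T_kind k : theory (LK K)).
Local Notation ec := (existentially_closed T).

(** Map [M] and [M'] to bilinear spaces [V] and [W]; the two tuples then have
the same type, a witness in [V] is matched in an extension of [W], and the
homomorphism from [M'] to that extension is an immersion. *)
Lemma ec_basic_transfer (M M' : structure (LK K)) n
    (theta : formula (LK K) n.+1) (v : 'I_n -> M) (v' : 'I_n -> M') :
  quantifier_free theta -> ec M -> ec M' ->
  (forall f, holds (basic_formula f) v -> holds (basic_formula f) v') ->
  holds (FEx theta) v -> holds (FEx theta) v'.
Proof.
move=> thetaqf [MT Mec] [M'T M'ec] vv' thetav.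
have [V [b [kb [h hh]]]] := model_completion MT.
have [W [c [kc [h' hh']]]] := model_completion M'T.
have hv : same_type b c (h \o v) (h' \o v').
  apply: same_type_basic => f fv; apply: (hh'); apply: vv'.
  (* The homomorphism to [V] is an immersion because [M] is e.c. *)
  by have [_] := Mec _ _ (fun s sT => sT _ _ kb) hh; apply.
have [x thetax] := hh _ _ _ thetav.
have [U [d [g [y [kd hg xy]]]]] := one_point_extension x kb kc hv.
have [_] := M'ec _ _ (fun s sT => sT _ _ kd) (homomorphism_comp hh' hg).
apply; exists y; exact: quantifier_free_same_type xy thetaqf thetax.
Qed.

(** An equivalence of positive formulas consists of two h-inductive sentences.
*)
Lemma equivalent_modulo_ec n (phi psi : formula (LK K) n) :
  equivalent_modulo (theory_ec T) phi psi <->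
  forall M, ec M -> forall v : 'I_n -> M, holds phi v <-> holds psi v.
Proof.
split=> [eqv M Mec v|eqv M MT v].
  by apply: eqv => s; apply.
split.
  apply: (MT (HInductive phi psi)) => N Nec w; exact: (eqv N Nec w).1.
apply: (MT (HInductive psi phi)) => N Nec w; exact: (eqv N Nec w).2.
Qed.

(** By induction on the formula, only a single existential quantifier in front
of a quantifier-free matrix has to be eliminated; the type of a tuple is
described by basic facts, which a finite type indexes. *)
Lemma finite_positive_QE : finite_set [set: K] -> positive_QE T.
Proof.
move=> /finite_seqP[s sK].
have Ks x : x \in s by have : [set: K] x by []; rewrite sK.
pose code x : seq_sub s := SeqSub (Ks x).
move=> n phi; elim: phi => {n}
  [n t u|n r ts|n|n|n phi [phi' [qphi phiE]] psi [psi' [qpsi psiE]]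
  |n phi [phi' [qphi phiE]] psi [psi' [qpsi psiE]]
  |n phi [theta [qtheta thetaE]]].
- by exists (FEq t u).
- by exists (FRel r ts).
- by exists FTop.
- by exists FBot.
- exists (FAnd phi' psi'); split=> /=; first by rewrite qphi.
  by move=> M MT v /=; rewrite (phiE M MT) (psiE M MT).
- exists (FOr phi' psi'); split=> /=; first by rewrite qphi.
  by move=> M MT v /=; rewrite (phiE M MT) (psiE M MT).
pose vectors := {ffun 'I_n -> seq_sub s}.
pose facts (i : vectors + vectors + 'I_n * 'I_n * seq_sub s) : basic_fact K n :=
  match i with
  | inl (inl a) => Vanish (fun j => ssval (a j))
  | inl (inr a) => NonVanish (fun j => ssval (a j))
  | inr (i, j, l) => ProductIs i j (ssval l)
  end.
have decode f : exists i, facts i = f.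
  have aE (a : 'I_n -> K) : (fun j => ssval ([ffun j => code (a j)] j)) = a.
    by apply: funext => j; rewrite ffunE.
  case: f => [a|a|i j l].
  - by exists (inl (inl [ffun j => code (a j)])); rewrite /= aE.
  - by exists (inl (inr [ffun j => code (a j)])); rewrite /= aE.
  - by exists (inr (i, j, code l)).
have [||psi [qpsi psiE]] := @finite_types_definable _ ec _ n
    (fun i => basic_formula (facts i)) (FEx theta).
- by move=> i; exact: basic_formula_qf.
- move=> M M' v v' Mec M'ec vv'; apply: ec_basic_transfer => // f.
  by have [i <-] := decode f; exact: vv'.
exists psi; split=> // M MT v.
rewrite -((equivalent_modulo_ec _ _).2 psiE M MT v).
by split=> -[x xv]; exists x; apply/(thetaE M MT).
Qed.

End Elimination.

(** * Failure of quantifier elimination over an infinite field *)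

Section InfiniteField.
Variables (K : fieldType) (k : kind).

Lemma lincomb_pair (V : lmodType K) a (x y : V) :
  lincomb a (pair_fun x y) = a ord0 *: x + a ord_max *: y.
Proof.
rewrite /lincomb big_ord_recl big_ord1 /pair_fun /=; congr (_ + a _ *: _).
exact: val_inj.
Qed.

(** Equations and products valid at [v] persist at every [w l], and each of
the finitely many inequations excludes finitely many [l]. *)
Lemma cofinite_specialization (V : lmodType K) (b : {biscalar V}) n
    (v : 'I_n -> V) (w : K -> 'I_n -> V) (psi : formula (LK K) n) :
  (forall a, lincomb a v = 0 -> forall l, lincomb a (w l) = 0) ->
  (forall a, lincomb a v <> 0 ->
     exists s : seq K, forall l, l \notin s -> lincomb a (w l) <> 0) ->
  (forall l i j, b (w l i) (w l j) = b (v i) (v j)) ->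
  quantifier_free psi -> holds (M := bilinear_structure b) psi v ->
  exists s : seq K, forall l, l \notin s ->
    holds (M := bilinear_structure b) psi (w l).
Proof.
elim: psi v w => {n}
  [n t u|n r ts|n|n|n phi IHphi psi IHpsi|n phi IHphi psi IHpsi|//]
  v w vanish nonvanish gram /=.
- move=> _; have [a aE] := term_lincomb t; have [a' a'E] := term_lincomb u.
  rewrite aE a'E => /lincomb_eq /vanish tu.
  by exists [::] => l _; rewrite aE a'E; apply/lincomb_eq.
- move=> _; have [a aE] := choice (fun i => term_lincomb (ts i)).
  case: r ts a aE => [|c] ts a aE /=; rewrite !aE; last first.
    move=> <-; exists [::] => l _; rewrite !aE !gram_lincomb.
    apply: eq_bigr => i _; congr (_ * _); apply: eq_bigr => j _.
    by rewrite gram.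
  move=> neq; have [|s sP] := nonvanish (fun i => a ord0 i - a ord_max i).
    by move/lincomb_eq.
  by exists s => l /sP ls; rewrite !aE => /lincomb_eq.
- by exists [::].
- by [].
- move=> /andP[qphi qpsi] [phiv psiv].
  have [s sP] := IHphi v w vanish nonvanish gram qphi phiv.
  have [t tP] := IHpsi v w vanish nonvanish gram qpsi psiv.
  exists (s ++ t) => l; rewrite mem_cat negb_or => /andP[ls lt].
  by split; [exact: sP|exact: tP].
- move=> /andP[qphi qpsi] [phiv|psiv].
    have [s sP] := IHphi v w vanish nonvanish gram qphi phiv.
    by exists s => l /sP; left.
  have [t tP] := IHpsi v w vanish nonvanish gram qpsi psiv.
  by exists t => l /tP; right.
Qed.

(** In saturated spaces this defines the pairs with [x0] not a multiple of
[x1], a condition that takes infinitely many inequations over an infinite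
field. *)
Definition separation : formula (LK K) 2 :=
  let y := Var ord0 in
  let x i := Var (lift ord0 i) in
  FEx (FAnd (@FRel (LK K) 3 (Product 1) (pair_fun (x ord0) y))
            (@FRel (LK K) 3 (Product 0) (pair_fun (x ord_max) y))).

Lemma holds_separation (V : lmodType K) (b : {biscalar V}) (x : 'I_2 -> V) :
  holds (M := bilinear_structure b) separation x <->
  exists y, b (x ord0) y = 1 /\ b (x ord_max) y = 0.
Proof.
by split=> -[y yP]; exists y; move: yP; rewrite /= !vcons_lift vcons0.
Qed.

Lemma not_separation_multiple (V : lmodType K) (b : {biscalar V}) l (x : V) :
  ~ holds (M := bilinear_structure b) separation (pair_fun (l *: x) x).
Proof.
move/holds_separation => [y [/= + xy]]; rewrite linearZl_LR /= xy mulr0.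
by move=> /esym/eqP; rewrite oner_eq0.
Qed.

Lemma compatible_partner (V : lmodType K) (f : {scalar V}) :
  exists g : {scalar V}, compatible k f g 0 /\ forall x, f x = 0 -> g x = 0.
Proof.
case: k; [by exists f|by exists f|exists (GRing.opp_fun f : {scalar V})].
by split=> [//|x /= ->]; rewrite oppr0.
Qed.

Lemma isotropic_extension (V : lmodType K) (b : {biscalar V}) n
    (v : 'I_n -> V) :
  saturated k b -> exists x, [/\ forall a, x <> lincomb a v,
    forall i, b (v i) x = 0, forall i, b x (v i) = 0 & b x x = 0].
Proof.
move=> satb.
have [a _|f f0] := @prescribed_functional _ _ _ v (fun=> 0).
  by rewrite big1 // => i _; rewrite mulr0.
have [g [fg g0]] := compatible_partner f.
have [x [xN fx gx xx]] := satb _ v f g 0 fg.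
by exists x; split=> // i; rewrite ?fx ?gx ?g0.
Qed.

(** In a saturated space there are a nonzero isotropic [y] and an isotropic
[x] that is orthogonal to [y] and not a multiple of it, and [separation] holds
of [(x, y)]. A quantifier-free equivalent holds of [(x, y)], hence of some [(l
y, y)] if [K] is infinite, against [not_separation_multiple]. *)
Lemma positive_QE_finite :
  positive_QE (T_kind k : theory (LK K)) -> finite_set [set: K].
Proof.
move=> QE; pose V := {freeg (generator K) / K}.
pose b : {biscalar V} := generic_form k.
have satb : saturated k b := @generic_saturated K k.
have [psi [qpsi /equivalent_modulo_ec psiE]] := QE _ separation.
have {}psiE := psiE _ (saturated_ec (generic_of_kind K k) satb).
have [y [yN _ _ yy]] := isotropic_extension (@no_args V) satb.
have [x [xN yx xy xx]] := isotropic_extension (fun i : 'I_1 => y) satb.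
have y0 : y <> 0.
  by move=> y0; apply: (yN (@no_args K)); rewrite /lincomb big_ord0.
pose v := pair_fun x y.
have indep a : lincomb a v = 0 -> a ord0 = 0 /\ a ord_max = 0.
  rewrite lincomb_pair => axy.
  have ax0 : a ord0 = 0.
    apply: contrapT => /eqP ax0; apply: (xN (fun=> - (a ord0)^-1 * a ord_max)).
    rewrite /lincomb big_ord1 mulNr scaleNr; apply: (scalerI ax0).
    rewrite scalerN scalerA mulrA mulfV // mul1r.
    by apply/eqP; rewrite -addr_eq0 axy.
  split=> //; move: axy; rewrite ax0 scale0r add0r => /eqP.
  by rewrite scaler_eq0 => /orP[/eqP|/eqP /y0].
have [f fv] : exists f : {scalar V}, forall i, f (v i) = pair_fun 1 0 i.
  apply: prescribed_functional => a /indep[a0 a1].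
  by rewrite big_ord_recl a0 big_ord1 /= mul0r mulr0 addr0.
have [g [fg _]] := compatible_partner f.
have [z [_ fz _ _]] := satb _ v f g 0 fg.
have psiv : holds (M := bilinear_structure b) psi v.
  by apply/psiE/holds_separation; exists z; rewrite !fz !fv.
have [s sP] : exists s : seq K, forall l, l \notin s ->
    holds (M := bilinear_structure b) psi (pair_fun (l *: y) y).
  apply: (cofinite_specialization _ _ _ qpsi psiv).
  - move=> a /indep[a0 a1] l; rewrite lincomb_pair a0 a1 !scale0r addr0 //.
  (* The combination [a0 (l y) + a1 y] vanishes only at [l = - a1 / a0], and
     never if [a0 = 0], since then [a1 <> 0]. *)
  - move=> a av; exists [:: - a ord_max / a ord0] => l.
    rewrite mem_seq1 => /eqP la; rewrite lincomb_pair scalerA -scalerDl => /eqP.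
    rewrite scaler_eq0 => /orP[|/eqP//]; rewrite addr_eq0 => /eqP aE.
    have [a0|a0] := eqVneq (a ord0) 0; last first.
      by apply: la; rewrite -aE mulrC mulKf.
    apply: av; move: aE; rewrite lincomb_pair a0 mul0r => /esym/eqP.
    by rewrite oppr_eq0 => /eqP ->; rewrite !scale0r addr0.
  - have isotropic (u : V) : b u y = 0 -> b y u = 0 -> b u u = 0 ->
        forall i j, b (pair_fun u y i) (pair_fun u y j) = 0.
      by move=> uy yu uu i j; rewrite /pair_fun; case: ifP; case: ifP.
    move=> l i j; rewrite !isotropic ?xx ?(xy ord0) ?(yx ord0) //.
    + by rewrite linearZl_LR yy /= mulr0.
    + by rewrite linearZr_LR yy /= mulr0.
    + by rewrite linearZl_LR linearZr_LR yy /= !mulr0.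
apply/finite_seqP; exists s; apply/seteqP; split=> // l _ /=.
by apply: contraT => /sP /psiE /not_separation_multiple.
Qed.

End InfiniteField.

Unset Implicit Arguments.

Theorem theorem4p13 (K : fieldType) (T : theory (LK K)) :
  [\/ T = T_bilinear K, T = T_symmetric K | T = T_alternating K] ->
  (positive_QE T <-> finite_set [set: K]).
Proof.
move=> /kind_of_theory[k ->]; split; first exact: positive_QE_finite.
exact: finite_positive_QE.
Qed.
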